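(* Let $M=x_0^{a_0}\cdots x_n^{a_n}$ be a degree $d$ monomial with integer exponents $0<a_0\le \cdots\le a_n$, regarded as a form both over $\mathbb{R}$ and over $\mathbb{C}$. Then $\mathrm{rk}_{\mathbb{R}}(M)=\mathrm{rk}_{\mathbb{C}}(M)$ if and only if $a_0=1$.
   Context: For a field $\mathbb{K}$ and a homogeneous polynomial $F\in\mathbb{K}[x_0,\ldots,x_n]$ of degree $d$, a Waring decomposition of $F$ over $\mathbb{K}$ is an expression $F=\sum_{i=1}^s c_iL_i^d$ with $c_i\in\mathbb{K}$ and $L_i\in\mathbb{K}[x_0,\ldots,x_n]$ linear forms (homogeneous of degree 1). The Waring rank of $F$ over $\mathbb{K}$, denoted $\mathrm{rk}_{\mathbb{K}}(F)$, is the smallest $s$ for which such a decomposition exists.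
   Formalization: The formal theorem assumes n ≥ 1 (at least two variables); for n = 0 the claim fails, since M = x_0^2 has rank 1 over both the reals and the complex numbers although a_0 = 2. *)

(* Defs.v *)
From mathcomp Require Import all_boot all_order all_algebra.
From mathcomp Require Import boolp reals complex.
From mathcomp Require Import mpoly.

Set Implicit Arguments.
Unset Strict Implicit.
Unset Printing Implicit Defensive.

Import GRing.Theory.
Local Open Scope ring_scope.

Section WaringRank.
Variables (K : fieldType) (m : nat).
Implicit Types (d s : nat) (F : {mpoly K[m]}).

(* The predicate [1.-homog] also holds of the zero polynomial; for m > 0 allowing
   [L i = 0] does not affect the rank, since [c i = 0] is allowed too. *)
Definition waring_decomposition d F s
    (c : 'I_s -> K) (L : 'I_s -> {mpoly K[m]}) : Prop :=
  (forall i, L i \is 1.-homog) /\ F = \sum_(i < s) c i *: L i ^+ d.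

Definition has_waring_decomposition d F s : Prop :=
  exists (c : 'I_s -> K) (L : 'I_s -> {mpoly K[m]}),
    waring_decomposition d F c L.

(* The degree [d] is an explicit argument because [F = 0] is homogeneous of
   every degree. The value 0 in the second branch is only a default: a form
   over a field of characteristic 0 always has a Waring decomposition. *)
Definition waring_rank d F : nat :=
  if pselect (exists s, `[< has_waring_decomposition d F s >]) is left exF
  then ex_minn exF else 0.

Lemma waring_rankP d F :
  (exists s, has_waring_decomposition d F s) ->
  has_waring_decomposition d F (waring_rank d F) /\
  forall s, has_waring_decomposition d F s -> (waring_rank d F <= s)%N.
Proof.
move=> [s0 Fs0]; rewrite /waring_rank; case: pselect => [exF|]; last first.
  by case; exists s0; apply/asboolP.
by case: ex_minnP => r /asboolP Fr r_min; split=> // s /asboolP /r_min.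
Qed.

End WaringRank.

Definition monomial_form (K : fieldType) (n : nat) (a : 'I_n.+1 -> nat) :
    {mpoly K[n.+1]} :=
  \prod_(i < n.+1) 'X_i ^+ a i.

(* Main.v *)
(* By polarization, M = \sum_j c_j L_j^d holds iff, up to scaling the c_j, the
   functional p |-> \sum_j c_j p(v_j) on forms of degree d extracts the
   coefficient of M, where v_j are the coefficients of L_j.  Dehomogenize at x_0
   and consider the box of monomials y^b with b_i <= a_i for i >= 1.  Multiplying
   a linear relation between them on the points by x_0^a_0 y^(a - b), with b in
   its support of maximal degree, contradicts the value of the functional.
   Hence the rank is at least the cardinal r of the box.  A grid of points gives
   r as soon as, for each i >= 1, the polynomial of its i-th coordinates is
   split with simple roots, and the a_0 coefficients below the leading one
   vanish: take roots of unity over the complex numbers, and for a_0 = 1 real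
   nodes with sum 0.

   If r real points suffice, the box is a basis of the functions on them.  The
   same argument shows that a monomial y^e outside the box reduces to degree at
   most |e| - a_0 - 1.  So for a_0 >= 2 multiplication by y_1^2 has zero diagonal
   in this basis, although its trace is the sum of the squares of the first
   coordinates, which is positive. *)
Require Import Defs.
From mathcomp Require Import all_boot all_order all_algebra.
From mathcomp Require Import all_solvable all_field.
From mathcomp Require Import boolp reals complex.
From mathcomp Require Import mpoly.
From mathcomp Require Import ring zify.

Set Implicit Arguments.
Unset Strict Implicit.
Unset Printing Implicit Defensive.

Import GRing.Theory Num.Theory.
Local Open Scope ring_scope.

(** * Coefficients of powers of linear forms *)

Definition linear_form (K : fieldType) m (v : 'I_m -> K) : {mpoly K[m]} :=
  \sum_(i < m) v i *: 'X_i.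

Lemma linear_form_homog (K : fieldType) m (v : 'I_m -> K) :
  linear_form v \is 1.-homog.
Proof. by apply: rpred_sum => i _; rewrite dhomogZ // dhomogX /= mdeg1. Qed.

Lemma dhomog1_linear_form (K : fieldType) m (p : {mpoly K[m]}) :
  p \is 1.-homog -> p = linear_form (fun i => p@_U_(i)).
Proof.
move=> p1; apply/mpolyP => b; rewrite raddf_sum /=.
under eq_bigr do rewrite mcoeffZ mcoeffX.
have [/mdeg1P[i /eqP ->]|b1] := boolP (mdeg b == 1%N).
  rewrite (bigD1 i) //= eqxx mulr1 big1 ?addr0 // => j ji.
  by rewrite -mcoeffX mcoeffXU (negPf ji) mulr0.
rewrite (dhomog_nemf_coeff p1) // big1 // => i _.
by case: (U_(i)%MM =P b) b1 => [<-|_]; rewrite ?mdeg1 ?mulr0.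
Qed.

Lemma mderiv_linear_form_exp (K : fieldType) m (v : 'I_m -> K) i k :
  mderiv i (linear_form v ^+ k.+1) = (k.+1%:R * v i) *: linear_form v ^+ k.
Proof.
have dL : mderiv i (linear_form v) = (v i)%:MP.
  rewrite linear_sum /= (bigD1 i) //= big1 => [|j ji].
    rewrite addr0 linearZ /= mderivX mnm1E eqxx scale1r.
    have -> : (U_(i) - U_(i) = 0)%MM.
      by apply/mnmP => j; rewrite mnmBE mnm0E subnn.
    by rewrite mpolyX0 -mul_mpolyC mulr1.
  by rewrite linearZ /= mderivX mnm1E (negPf ji) scale0r scaler0.
elim: k => [|k IH]; first by rewrite dL expr0 mul1r -mul_mpolyC mulr1.
rewrite exprS mderivM dL IH mul_mpolyC -scalerAr -exprS -scalerDl.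
by rewrite [in RHS]mulrSr mulrDl mul1r addrC.
Qed.

(** The multinomial formula with denominators cleared. The induction differentiates once along a
    variable that occurs in [b]. *)
Lemma mcoeff_linear_form_exp (K : fieldType) m (v : 'I_m -> K) b :
  (linear_form v ^+ mdeg b)@_b * (\prod_(i < m) (b i)`!)%:R
  = (mdeg b)`!%:R * \prod_(i < m) v i ^+ b i.
Proof.
move: {-1}(mdeg b) (erefl (mdeg b)) => k; elim: k b => [|k IH] b bk.
  move/eqP: bk; rewrite mdeg_eq0 => /eqP ->.
  rewrite expr0 mcoeff1 eqxx !big1 ?mulr1 // => i _; first by rewrite mnm0E.
  by rewrite mnm0E.
have [i bi] : exists i, (0 < b i)%N.
  apply/existsP; apply: contra_eqT bk; rewrite negb_exists => /forallP b0.
  by rewrite mdegE big1 // => i _; apply/eqP; move: (b0 i); rewrite lt0n negbK.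
have Db : b = (b - U_(i) + U_(i))%MM.
  rewrite submK //; apply/mnm_lepP => j; rewrite mnm1E.
  by case: eqP => [<-|].
move: (b - U_(i))%MM Db => b' {bi} Db; rewrite Db in bk *.
have {}bk : mdeg b' = k by move: bk; rewrite mdegD mdeg1 addn1 => -[].
(* Stated for any commutative law, to split off index [i] both from the product of factorials and
   from the product of powers in [K]. *)
have E (T : Type) (x : T) (op : Monoid.com_law x) (f : 'I_m -> nat -> T) :
  \big[op/x]_(j < m) f j ((b' + U_(i))%MM j) =
     op (f i (b' i).+1) (\big[op/x]_(j < m | j != i) f j (b' j)).
  rewrite (bigD1 i) //= mnmDE mnm1E eqxx addn1; congr (op _ _).
  by apply: eq_bigr => j ji; rewrite mnmDE mnm1E eq_sym (negPf ji) addn0.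
rewrite (E _ _ _ (fun _ k => k`!)) (E _ _ _ (fun j k => v j ^+ k)) /=.
have := IH b' bk; rewrite (bigD1 i) //= [in RHS](bigD1 i) //= => {}IH.
have := mcoeff_deriv i b' (linear_form v ^+ k.+1).
rewrite mderiv_linear_form_exp mcoeffZ -[RHS]mulr_natr => D.
rewrite !factS natrM in IH *; rewrite !natrM (exprS (v i)).
by rewrite !mulrA -D -!mulrA IH; ring.
Qed.

(** * Waring decompositions as functionals on forms *)

Lemma monomial_formE (K : fieldType) n (a : 'I_n.+1 -> nat) :
  monomial_form K a = 'X_[[multinom a i | i < n.+1]].
Proof. by rewrite mpolyXE_id; apply: eq_bigr => i _; rewrite mnmE. Qed.

Lemma natf_fact_neq0 (K : numFieldType) k : k`!%:R != 0 :> K.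
Proof. by rewrite pnatr_eq0 -lt0n fact_gt0. Qed.

Lemma natf_prod_fact_neq0 (K : numFieldType) m (b : 'I_m -> nat) :
  (\prod_(i < m) (b i)`!)%:R != 0 :> K.
Proof. by rewrite pnatr_eq0 -lt0n prodn_gt0 // => i; rewrite fact_gt0. Qed.

(** Coefficients are compared after multiplication by the factorials of the exponents, which are
    nonzero in characteristic 0. *)
Lemma monomial_form_sum_powers (K : numFieldType) n d (a : 'I_n.+1 -> nat)
    (J : finType) (c : J -> K) (v : J -> 'I_n.+1 -> K) :
  d = (\sum_(i < n.+1) a i)%N ->
  monomial_form K a = \sum_j c j *: linear_form (v j) ^+ d <->
  forall b : 'I_n.+1 -> nat, (\sum_(i < n.+1) b i)%N = d ->
    \sum_j c j * (d`!%:R * \prod_(i < n.+1) v j i ^+ b i)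
    = [forall i, b i == a i]%:R * (\prod_(i < n.+1) (a i)`!)%:R.
Proof.
move=> da; pose ma := [multinom a i | i < n.+1].
have mdega : mdeg ma = d.
  by rewrite mdegE da; apply: eq_bigr => i _; rewrite mnmE.
have ma_eq (b : 'X_{1..n.+1}) : (ma == b) = [forall i, b i == a i].
  apply/eqP/forallP => [<- i|ab]; first by rewrite mnmE.
  by apply/mnmP => i; rewrite mnmE (eqP (ab i)).
rewrite monomial_formE -/ma; split=> [E b bd|E].
  pose mb := [multinom b i | i < n.+1].
  have mdegb : mdeg mb = d.
    by rewrite mdegE -bd; apply: eq_bigr => i _; rewrite mnmE.
  have mbE i : mb i = b i by rewrite mnmE.
  transitivity ('X_[ma]@_mb * (\prod_(i < n.+1) (mb i)`!)%:R : K); last first.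
    rewrite mcoeffX ma_eq; under eq_forallb do rewrite mbE.
    case: forallP => [ab|_]; rewrite ?mul0r // !mul1r; congr _%:R.
    by apply: eq_bigr => i _; rewrite mbE (eqP (ab i)).
  rewrite E raddf_sum mulr_suml; apply: eq_bigr => j _ /=.
  rewrite mcoeffZ -mulrA -mdegb mcoeff_linear_form_exp.
  by under [in RHS]eq_bigr do rewrite mbE.
apply/mpolyP => b; rewrite raddf_sum /= mcoeffX.
have [bd|bd] := eqVneq (mdeg b) d; last first.
  rewrite big1 => [|j _]; first by case: (ma =P b) bd => // <-; rewrite mdega eqxx.
  have := dhomogMn d (linear_form_homog (v j)); rewrite mul1n => Ld.
  by rewrite mcoeffZ (dhomog_nemf_coeff Ld) ?mulr0.
apply: (mulIf (natf_prod_fact_neq0 K b)).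
transitivity ([forall i, b i == a i]%:R * (\prod_(i < n.+1) (a i)`!)%:R : K).
  rewrite ma_eq; case: forallP => [ab|_]; rewrite ?mul0r // !mul1r; congr _%:R.
  by apply: eq_bigr => i _; rewrite (eqP (ab i)).
rewrite -E; last by rewrite -bd mdegE.
rewrite mulr_suml; apply: eq_bigr => j _.
by rewrite mcoeffZ -mulrA -bd mcoeff_linear_form_exp.
Qed.

(* The functional [p |-> \sum_j c j * p (u j, w j)] extracts the coefficient of
   x_0^a0 x^a; [u] holds the coordinates along x_0. *)
Definition dual_points (K : fieldType) n (a0 : nat) (a : 'I_n -> nat)
    (J : finType) (c u : J -> K) (w : J -> 'I_n -> K) : Prop :=
  forall k (b : 'I_n -> nat),
    (k + \sum_(i < n) b i = a0 + \sum_(i < n) a i)%N ->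
    \sum_j c j * (u j ^+ k * \prod_(i < n) w j i ^+ b i)
    = [forall i, b i == a i]%:R.

Lemma has_waring_decomposition_dual_points (K : numFieldType) n d s
    (a : 'I_n.+1 -> nat) :
  d = (\sum_(i < n.+1) a i)%N ->
  has_waring_decomposition d (monomial_form K a) s ->
  exists (c u : 'I_s -> K) (w : 'I_s -> 'I_n -> K),
    dual_points (a ord0) (fun i => a (lift ord0 i)) c u w.
Proof.
move=> da [c [L [L1 E]]].
pose v j i := (L j)@_U_(i); pose A := (\prod_(i < n.+1) (a i)`!)%:R : K.
have {E} : monomial_form K a = \sum_j c j *: linear_form (v j) ^+ d.
  by rewrite E; apply: eq_bigr => j _; rewrite -dhomog1_linear_form.
move/(monomial_form_sum_powers _ _ da) => E.
(* The multinomial factor d!/a! is absorbed into the coefficients. *)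
exists (fun j => c j * d`!%:R / A), (v ^~ ord0), (fun j i => v j (lift ord0 i)).
move=> k b; rewrite -[X in _ = X]big_ord_recl -da => bd.
pose b' i := oapp b k (unlift ord0 i).
have b'0 : b' ord0 = k by rewrite /b' unlift_none.
have b'S i : b' (lift ord0 i) = b i by rewrite /b' liftK.
have {}bd : (\sum_(i < n.+1) b' i)%N = d.
  by rewrite big_ord_recl b'0; under eq_bigr do rewrite b'S.
have -> : [forall i, b i == a (lift ord0 i)] = [forall i, b' i == a i].
  apply/forallP/forallP => ab i; last by rewrite -b'S.
  (* The exponents of x_0 agree because the total degrees do. *)
  case: (unliftP ord0 i) => [i' ->|->]; first by rewrite b'S.
  move/eqP: bd; rewrite da !big_ord_recl.
  by under eq_bigr do rewrite b'S (eqP (ab _)); rewrite eqn_add2r.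
apply: (mulIf (natf_prod_fact_neq0 K a)); rewrite -E // mulr_suml.
apply: eq_bigr => j _; rewrite -/A big_ord_recl b'0.
under [in RHS]eq_bigr do rewrite b'S.
by rewrite [LHS]mulrAC mulfVK ?natf_prod_fact_neq0 // mulrA.
Qed.

(** The index type is arbitrary so that a grid of points can be indexed by a box. *)
Lemma dual_points_has_waring_decomposition (K : numFieldType) n d
    (a : 'I_n.+1 -> nat) (J : finType) (c u : J -> K) (w : J -> 'I_n -> K) :
  d = (\sum_(i < n.+1) a i)%N ->
  dual_points (a ord0) (fun i => a (lift ord0 i)) c u w ->
  has_waring_decomposition d (monomial_form K a) #|J|.
Proof.
move=> da cuw; pose A := (\prod_(i < n.+1) (a i)`!)%:R : K.
pose v j i := oapp (w j) (u j) (unlift ord0 i).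
exists (fun j => c (enum_val j) * A / d`!%:R), (fun j => linear_form (v (enum_val j))).
split=> [i|]; first exact: linear_form_homog.
rewrite -(big_enum_val (fun j => (c j * A / d`!%:R) *: linear_form (v j) ^+ d)) /=.
apply/monomial_form_sum_powers => // b bd.
under eq_bigr => j _ do
  rewrite mulrA mulfVK ?natf_fact_neq0 // mulrAC big_ord_recl /v unlift_none /=.
rewrite -mulr_suml; congr (_ * _).
under eq_bigr do under eq_bigr do rewrite liftK.
rewrite cuw -?big_ord_recl ?bd //; congr (nat_of_bool _)%:R.
apply/forallP/forallP => ab i; last exact: ab.
case: (unliftP ord0 i) => [i' ->//|->].
move/eqP: bd; rewrite da !big_ord_recl.
by under eq_bigr do rewrite (eqP (ab _)); rewrite eqn_add2r.
Qed.

(** * Independence of the box monomials on the points *)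

Notation box a := (fprod (fun i => 'I_(a i).+1)).

Definition box_deg n (a : 'I_n -> nat) (b : box a) := (\sum_(i < n) b i)%N.

Lemma box_le n (a : 'I_n -> nat) (b : box a) i : (b i <= a i)%N.
Proof. by rewrite -ltnS. Qed.

Lemma box_val_inj n (a : 'I_n -> nat) (b b' : box a) :
  (forall i, b i = b' i :> nat) -> b = b'.
Proof. by move=> bb'; apply/fprodP => i; apply/val_inj/bb'. Qed.

Lemma box_surj n (a e : 'I_n -> nat) : (forall i, (e i <= a i)%N) ->
  exists b : box a, forall i, b i = e i :> nat.
Proof.
by move=> ea; exists (fprod_of_fun (fun i => inord (e i))) => i;
  rewrite fprodE inordK // ltnS.
Qed.

Section DualPoints.
Variables (K : fieldType) (n a0 : nat) (a : 'I_n -> nat) (J : finType).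
Variables (c u : J -> K) (w : J -> 'I_n -> K).
Hypothesis cuw : dual_points a0 a c u w.

(** Multiplying by y^(a - b) moves the extracted exponent from [a] to [b]; the degree hypothesis
    makes the total degree that of the monomial. *)
Lemma dual_points_shift k (e : 'I_n -> nat) (b : box a) :
  (k + \sum_(i < n) e i = a0 + box_deg b)%N ->
  \sum_j c j * (u j ^+ k * \prod_(i < n) w j i ^+ e i *
                \prod_(i < n) w j i ^+ (a i - b i))
  = [forall i, e i == b i]%:R.
Proof.
move=> ke; under eq_bigr do rewrite -mulrA -big_split /=.
under eq_bigr do under eq_bigr do rewrite -exprD.
rewrite (cuw (b := fun i => (e i + (a i - b i))%N)).
  congr (nat_of_bool _)%:R; apply: eq_forallb => i; have := box_le b i.
  by move=> ba; apply/eqP/eqP; lia.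
have ba : (box_deg b <= \sum_(i < n) a i)%N.
  by apply: leq_sum => i _; apply: box_le.
rewrite big_split /= sumnB => [|i _]; last exact: box_le.
by rewrite -/(box_deg b); move: ke ba; set x := \sum_(_ < n) e _; set y := \sum_(_ < n) a _; lia.
Qed.

(** The functional shifted to [b0] kills every term of the homogenized relation except the one at
    [b0]. The bound on the support keeps the exponents of [u j] free of truncation. *)
Lemma top_coef_eq0 (g : box a -> K) (b0 : box a) (h : J -> K) :
  (forall b, g b != 0 -> (box_deg b <= box_deg b0)%N) ->
  (forall j, \sum_b g b * (u j ^+ (a0 + box_deg b0 - box_deg b) *
                           \prod_(i < n) w j i ^+ b i) = h j) ->
  \sum_j c j * (h j * \prod_(i < n) w j i ^+ (a i - b0 i)) = 0 ->
  g b0 = 0.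
Proof.
move=> gb0 gh <-; under eq_bigr do rewrite -gh mulr_suml mulr_sumr.
rewrite exchange_big /= (bigD1 b0) //= [X in _ + X]big1 ?addr0 => [|b bb0].
  under eq_bigr do rewrite -mulrA mulrCA; rewrite -mulr_sumr.
  rewrite dual_points_shift; last by rewrite addnK.
  by rewrite (introT forallP) ?mulr1 // => i.
have [->|gb] := eqVneq (g b) 0.
  by rewrite big1 // => j _; rewrite !mul0r mulr0.
under eq_bigr do rewrite -mulrA mulrCA; rewrite -mulr_sumr.
rewrite dual_points_shift; last first.
  by rewrite -/(box_deg b) subnK // (leq_trans (gb0 _ gb)) ?leq_addl.
case: forallP => [bb|_]; last by rewrite mulr0.
by case/eqP: bb0; apply: box_val_inj => i; apply/eqP.
Qed.

(** The leading factor makes even the constant monomial vanish at points at infinity, where [u j] is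
    0 and the empty product would give 1. *)
Definition affine_mon j (e : 'I_n -> nat) : K :=
  (u j != 0)%:R * \prod_(i < n) (w j i / u j) ^+ e i.

Lemma affine_mon_homogenize j D (e : 'I_n -> nat) :
  u j != 0 -> (\sum_(i < n) e i <= D)%N ->
  u j ^+ D * affine_mon j e
  = u j ^+ (D - \sum_(i < n) e i) * \prod_(i < n) w j i ^+ e i.
Proof.
move=> u0 eD; rewrite /affine_mon u0 mul1r.
under eq_bigr do rewrite exprMn; rewrite big_split /= -expr_sum.
by rewrite exprVn mulrCA mulrC exprB // unitfE.
Qed.

Lemma affine_mon_free (g : box a -> K) : (0 < a0)%N ->
  (forall j, \sum_b g b * affine_mon j (fun i => b i) = 0) ->
  forall b, g b = 0.
Proof.
move=> a0_gt0 g0 b1; apply/eqP; apply: contraT => gb1.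
have [b0 gb0 b0max] :=
  @arg_maxnP _ b1 (fun b => g b != 0) (@box_deg n a) gb1.
case/eqP: gb0; apply: (@top_coef_eq0 g b0 (fun=> 0)) => // [j|]; last first.
  by rewrite big1 // => j _; rewrite mul0r mulr0.
(* At infinity every term with nonzero coefficient carries a power of [u j] of exponent at least
   [a0], hence vanishes. *)
have [u0|u0] := eqVneq (u j) 0.
  rewrite big1 // => b _; have [->|/b0max/= gb] := eqVneq (g b) 0.
    by rewrite mul0r.
  by rewrite u0 expr0n; case: eqP => [|_]; [lia|rewrite mul0r mulr0].
transitivity (u j ^+ (a0 + box_deg b0) *
              \sum_b g b * affine_mon j (fun i => b i)).
  rewrite mulr_sumr; apply: eq_bigr => b _; have [->|/b0max/= gb] := eqVneq (g b) 0.
    by rewrite !mul0r mulr0.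
  by rewrite [RHS]mulrCA affine_mon_homogenize // -/(box_deg b); lia.
by rewrite g0 mulr0.
Qed.

(** Otherwise the relation homogenizes in degree [a0 + box_deg b0], with [b0] of maximal degree in
    the support. The functional shifted to [b0] kills y^e, because [e] leaves the box at [i0], and
    so [g b0] would be 0. *)
Lemma affine_mon_reduction (e : 'I_n -> nat) i0 (g : box a -> K) :
  (forall j, u j != 0) -> (a i0 < e i0)%N ->
  (forall j, \sum_b g b * affine_mon j (fun i => b i) = affine_mon j e) ->
  forall b, g b != 0 -> (box_deg b + a0 < \sum_(i < n) e i)%N.
Proof.
move=> u0 ei0 ge b1 gb1; rewrite ltnNge; apply/negP => le_e.
have [b0 gb0 b0max] :=
  @arg_maxnP _ b1 (fun b => g b != 0) (@box_deg n a) gb1.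
have {}le_e : (\sum_(i < n) e i <= a0 + box_deg b0)%N.
  by have := b0max _ gb1; lia.
pose h j := u j ^+ (a0 + box_deg b0 - \sum_(i < n) e i) * \prod_(i < n) w j i ^+ e i.
case/eqP: gb0; apply: (@top_coef_eq0 g b0 h) => // [j|]; last first.
  rewrite dual_points_shift ?subnK //; case: forallP => // /(_ i0)/eqP.
  by have := box_le b0 i0; lia.
rewrite /h -affine_mon_homogenize // -ge mulr_sumr.
apply: eq_bigr => b _; have [->|/b0max/= gb] := eqVneq (g b) 0.
  by rewrite !mul0r mulr0.
by rewrite [RHS]mulrCA affine_mon_homogenize // -/(box_deg b); lia.
Qed.

End DualPoints.

(** * Lower bound for the rank, and the obstruction over real fields *)

Definition affine_mon_mx (K : fieldType) n (a : 'I_n -> nat) s (u : 'I_s -> K)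
    (w : 'I_s -> 'I_n -> K) : 'M[K]_(#|{: box a}|, s) :=
  \matrix_(k, j) affine_mon u w j (fun i => (enum_val k : box a) i).

Lemma affine_mon_mx_free (K : fieldType) n a0 (a : 'I_n -> nat) s
    (c u : 'I_s -> K) (w : 'I_s -> 'I_n -> K) :
  (0 < a0)%N -> dual_points a0 a c u w -> row_free (affine_mon_mx a u w).
Proof.
move=> a0_gt0 cuw; apply/inj_row_free => v vE.
have v0 := affine_mon_free cuw (g := fun b => v 0 (enum_rank b)) a0_gt0.
apply/rowP => k; rewrite mxE -(enum_valK k) v0 // => j.
move/rowP: vE => /(_ j); rewrite !mxE => vEj; rewrite -[RHS]vEj.
rewrite [RHS](reindex _ (onW_bij _ (@enum_rank_bij (box a)))) /=.
by apply: eq_bigr => b _; rewrite mxE enum_rankK.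
Qed.

Lemma dual_points_card_ge (K : fieldType) n a0 (a : 'I_n -> nat) s
    (c u : 'I_s -> K) (w : 'I_s -> 'I_n -> K) :
  (0 < a0)%N -> dual_points a0 a c u w -> (#|{: box a}| <= s)%N.
Proof.
move=> a0_gt0 /(affine_mon_mx_free a0_gt0)/eqP <-; exact: rank_leq_col.
Qed.

(* [N] below is the matrix of multiplication by [y j ^+ 2]. *)
Lemma real_dual_points_card_neq (K : realFieldType) n a0 (a : 'I_n -> nat) i0
    (c u : 'I_#|{: box a}| -> K) (w : 'I_#|{: box a}| -> 'I_n -> K) :
  (1 < a0)%N -> (0 < a i0)%N -> ~ dual_points a0 a c u w.
Proof.
move=> a0_gt1 ai0 cuw; have a0_gt0 := ltnW a0_gt1.
(* There are as many points as box monomials, so the evaluation matrix is square and row freeness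
   makes it invertible. *)
have := affine_mon_mx_free a0_gt0 cuw; rewrite row_free_unit.
set E := affine_mon_mx a u w => E_unit.
(* A point at infinity would give a zero column. *)
have u0 j : u j != 0.
  apply/eqP => uj0; have : col j E = 0.
    by apply/colP => k; rewrite !mxE /affine_mon uj0 eqxx mul0r.
  rewrite colE => /(congr1 (mulmx (invmx E))); rewrite mulKmx // mulmx0.
  by move/colP/(_ j); rewrite !mxE !eqxx => /eqP; rewrite oner_eq0.
pose y j := w j i0 / u j.
have [N NE trN] : exists2 N, N *m E = E *m diag_mx (\row_j y j ^+ 2)
    & \tr N = \sum_j y j ^+ 2.
  exists (E *m diag_mx (\row_j y j ^+ 2) *m invmx E); first exact: mulmxKV.
  rewrite mxtrace_mulC mulKmx // mxtrace_diag.
  by apply: eq_bigr => k _; rewrite mxE.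
have {}NE (b : box a) j : \sum_(b' : box a)
      N (enum_rank b) (enum_rank b') * affine_mon u w j (fun i => b' i)
    = affine_mon u w j (fun i => b i + (i == i0) * 2)%N.
  transitivity ((N *m E) (enum_rank b) j).
    rewrite mxE (reindex _ (onW_bij _ (@enum_rank_bij (box a)))) /=.
    by apply: eq_bigr => b' _; rewrite mxE enum_rankK.
  rewrite NE mul_mx_diag !mxE enum_rankK /affine_mon u0 !mul1r.
  under [RHS]eq_bigr do rewrite exprD; rewrite big_split /=; congr (_ * _).
  by rewrite (bigD1 i0) //= eqxx mul1n big1 ?mulr1 // => i /negPf ->.
have diagN k : N k k = 0.
  rewrite -(enum_valK k); set b : box a := enum_val k.
  (* If raising the exponent at [i0] by 2 stays in the box, the product is another basis monomial
     [b'], so row [b] of [N] is 0 at [b]. *)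
  have [bi0|bi0] := leqP (b i0 + 2) (a i0).
    have [|b' b'E] := @box_surj _ a (fun i => b i + (i == i0) * 2)%N.
      by move=> i; case: eqP => [->//|_]; rewrite addn0 box_le.
    have b'b : (b == b') = false.
      by apply/eqP => bb'; have := b'E i0; rewrite -bb' eqxx; lia.
    have := affine_mon_free cuw
      (g := fun x => N (enum_rank b) (enum_rank x) - (x == b')%:R) a0_gt0.
    move=> /(_ _ b); rewrite b'b subr0; apply=> j.
    under eq_bigr do rewrite mulrBl; rewrite sumrB NE.
    rewrite (bigD1 b') //= eqxx mul1r big1 ?addr0 => [|b1 /negPf ->].
      rewrite /affine_mon; under [X in _ - _ * X]eq_bigr do rewrite b'E.
      by rewrite subrr.
    by rewrite mul0r.
  (* Outside the box, a nonzero diagonal entry would give [box_deg b + a0 < box_deg b + 2], against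
     [1 < a0]. *)
  apply/eqP; apply: contraT => Nbb.
  have ei0 : (a i0 < b i0 + (i0 == i0) * 2)%N by rewrite eqxx.
  have := affine_mon_reduction cuw u0 ei0 (NE b) Nbb.
  rewrite big_split /= -/(box_deg b) (bigD1 i0) //= eqxx big1; first lia.
  by move=> i /negPf ->.
have y0 j : y j = 0.
  have : \sum_j y j ^+ 2 = 0.
    by rewrite -trN /mxtrace big1.
  move/eqP; rewrite psumr_eq0 => [/allP/(_ j)|k _]; last exact: sqr_ge0.
  by rewrite mem_index_enum sqrf_eq0 => /(_ isT)/eqP.
(* As [a i0] is positive, the monomial y_i0 lies in the box; it vanishes at all points, against
   independence. *)
have [|b bE] := @box_surj _ a (fun i => (i == i0) : nat).
  by move=> i; case: eqP => [->|].
have := affine_mon_free cuw (g := fun x => (x == b)%:R) a0_gt0.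
move=> /(_ _ b); rewrite eqxx => /(_ _)/eqP; rewrite oner_eq0; case/(_ _)/notF => j.
rewrite (bigD1 b) //= eqxx mul1r big1 ?addr0 => [|b' /negPf ->]; last first.
  by rewrite mul0r.
by rewrite /affine_mon (bigD1 i0) //= bE eqxx -/(y j) y0 expr1 mul0r mulr0.
Qed.

(** * Grids of nodes attaining the bound *)

Lemma sum_box_prod (K : comPzSemiRingType) n (a : 'I_n -> nat)
    (F : forall i, 'I_(a i).+1 -> K) :
  \sum_(b : box a) \prod_(i < n) F i (b i)
  = \prod_(i < n) \sum_(j < (a i).+1) F i j.
Proof.
pose P i := [ffun j => F i j].
transitivity (\sum_(b : box a) \prod_(i in 'I_n) P i (b i)).
  by apply: eq_bigr => b _; apply: eq_bigr => i _; rewrite ffunE.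
(* [untag] extends each [P i] by 0 to the disjoint union of the index types, where distributivity
   over ordinary functions applies. *)
rewrite big_fprod -(bigA_distr_big_dep _ (fun i => untag 0 (P i))).
apply: eq_bigr => i _; transitivity (\sum_j P i j).
  exact/esym/(big_tag (fun i => P i : _ -> K) i).
by apply: eq_bigr => j _; rewrite ffunE.
Qed.

(* The functional below reads off the coefficient of ['X^m] in the remainder
   modulo ['X^m.+1 - g], whose roots are the nodes [x]. *)
Lemma node_functional (K : fieldType) m t (x : 'I_m.+1 -> K) (g : {poly K}) :
  injective x -> (size g + t <= m.+1)%N ->
  (forall j, x j ^+ m.+1 = g.[x j]) ->
  exists c : 'I_m.+1 -> K, forall k, (k <= m + t)%N ->
    \sum_j c j * x j ^+ k = (k == m)%:R.
Proof.
move=> x_inj size_g xg.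
pose V := Vandermonde m.+1 (\row_j x j).
have V_unit : V \in unitmx.
  rewrite unitmxE unitfE det_Vandermonde prodf_seq_neq0.
  apply/allP => i _ /=; rewrite prodf_seq_neq0; apply/allP => j _ /=.
  apply/implyP => ij; rewrite !mxE subr_eq0; apply: contraTneq ij => /x_inj ->.
  by rewrite ltnn.
(* The weights solve the Vandermonde system, so they read off the coefficient of X^m of any
   polynomial of degree at most [m]. *)
pose c := invmx V *m delta_mx ord_max 0 : 'cV_m.+1.
have cp (p : {poly K}) : (size p <= m.+1)%N -> \sum_j c j 0 * p.[x j] = p`_m.
  move=> size_p.
  under eq_bigr do rewrite (horner_coef_wide _ size_p) mulr_sumr.
  rewrite exchange_big /=.
  transitivity (\sum_(i < m.+1) p`_i * (V *m c) i 0).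
    apply: eq_bigr => i _; rewrite mxE mulr_sumr; apply: eq_bigr => j _.
    by rewrite !mxE mulrCA; congr (_ * _); rewrite mulrC.
  rewrite mulKVmx // (bigD1 ord_max) //= mxE !eqxx mulr1 big1 ?addr0 // => i ii.
  by rewrite mxE (negPf ii) mulr0.
exists (c ^~ 0) => k km; have [lekm|ltmk] := leqP k m.
  under eq_bigr do rewrite -hornerXn.
  by rewrite cp ?coefXn 1?eq_sym // size_polyXn.
(* On the nodes X^k agrees with X^(k - m - 1) * g, whose degree is below [m] by the bound on
   [size g]. *)
rewrite (gtn_eqF ltmk) -(subnK ltmk).
under eq_bigr do rewrite exprD xg -hornerXn -hornerM.
have sz : (size ('X^(k - m.+1) * g)%R <= m)%N.
  by rewrite (leq_trans (size_polyMleq _ _)) // size_polyXn; lia.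
by rewrite cp ?nth_default // ltnW.
Qed.

(** The functional is the tensor product of the one-variable node functionals, at points with
    x_0-coordinate 1. *)
Lemma box_dual_points (K : fieldType) n a0 (a : 'I_n -> nat)
    (x : forall i, 'I_(a i).+1 -> K) (g : 'I_n -> {poly K}) :
  (forall i, injective (x i)) -> (forall i, size (g i) + a0 <= (a i).+1)%N ->
  (forall i j, x i j ^+ (a i).+1 = (g i).[x i j]) ->
  exists (c u : box a -> K) (w : box a -> 'I_n -> K), dual_points a0 a c u w.
Proof.
move=> x_inj size_g xg.
have [c cx] : exists c : forall i, 'I_(a i).+1 -> K,
    forall i k, (k <= a i + a0)%N -> \sum_j c i j * x i j ^+ k = (k == a i)%:R.
  have ex i := node_functional (x_inj i) (size_g i) (xg i).
  by exists (fun i => projT1 (cid (ex i))) => i; case: cid.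
exists (fun b => \prod_i c i (b i)), (fun=> 1), (fun b i => x i (b i)) => k e ke.
under eq_bigr do rewrite expr1n mul1r -big_split /=.
rewrite (sum_box_prod (fun i j => c i j * x i j ^+ e i)).
have [/forallP ea|] := boolP [forall i, e i <= a i + a0]%N.
  under eq_bigr do rewrite cx //.
  case: forallP => [eqa|neqa]; first by rewrite big1 // => i _; rewrite eqa.
  apply/eqP; rewrite prodf_seq_eq0; apply/hasP.
  have /existsP[i ia] : [exists i, e i != a i].
    by rewrite -negb_forall; apply/forallP.
  by exists i; rewrite ?mem_index_enum //= (negPf ia).
(* An exponent beyond the range of its node functional forces, by total degree, another one below
   [a i], whose factor is 0. *)
rewrite negb_forall => /existsP[i0]; rewrite -ltnNge => ei0.
have [i ei] : exists i, (e i < a i)%N.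
  apply/existsP; apply: contraLR ei0; rewrite negb_exists -leqNgt => /forallP ae.
  have {}ae i : (a i <= e i)%N by rewrite leqNgt.
  have : (\sum_(i | i != i0) a i <= \sum_(i | i != i0) e i)%N by apply: leq_sum.
  by move: ke; rewrite (bigD1 i0) //= [in RHS](bigD1 i0) //=; lia.
rewrite (bigD1 i) //= cx ?(ltn_eqF ei) ?mul0r; last lia.
by case: forallP => // /(_ i0)/eqP ei0'; move: ei0; rewrite ei0'; lia.
Qed.

(** X^(m+1) - 1 splits with simple roots, so one of them is primitive, and its powers are the nodes,
    with remainder [g = 1]. *)
Lemma unity_nodes (C : numClosedFieldType) m :
  exists2 x : 'I_m.+1 -> C, injective x & forall j, x j ^+ m.+1 = 1.
Proof.
pose p : {poly C} := 'X^(m.+1) - 1; have [r Dp] := closed_field_poly_normal p.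
rewrite (monicP _) ?monicXnsubC // scale1r in Dp.
have r1 : all m.+1.-unity_root r.
  by apply/allP => z; rewrite -root_prod_XsubC -Dp.
have size_r : (m.+1 < (size r).+1)%N.
  by rewrite -(size_prod_XsubC r id) -Dp size_XnsubC.
have [|z _ z_prim] := hasP (has_prim_root (ltn0Sn m) r1 _ size_r).
  by rewrite -separable_prod_XsubC -Dp separable_Xn_sub_1 // pnatr_eq0.
exists (fun j : 'I_m.+1 => z ^+ j) => [i j /eqP|j].
  by rewrite (eq_prim_root_expr z_prim) !modn_small // => /eqP/val_inj.
by rewrite exprAC (prim_expr_order z_prim) expr1n.
Qed.

Lemma balanced_nodes (K : numFieldType) m :
  exists (x : 'I_m.+1 -> K) (g : {poly K}),
    [/\ injective x, (size g <= m)%N & forall j, x j ^+ m.+1 = g.[x j]].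
Proof.
(* These are the values 2j - m, symmetric about 0. *)
pose x (j : 'I_m.+1) : K := j%:R - (rev_ord j)%:R.
pose p := \prod_(z <- codom x) ('X - z%:P).
have size_x : size (codom x) = m.+1 by rewrite size_codom card_ord.
have size_p : size p = m.+2 by rewrite size_prod_XsubC size_x.
have sum_x : \sum_(z <- codom x) z = 0.
  rewrite big_image /x sumrB [X in _ - X](reindex_inj rev_ord_inj).
  by under [X in _ - X]eq_bigr do rewrite rev_ordK; rewrite subrr.
exists x, ('X^(m.+1) - p); split=> [i j|| j].
- rewrite /x => /eqP; rewrite subr_eq addrAC eq_sym subr_eq -!natrD eqr_nat /=.
  by move=> /eqP ij; apply: val_inj => /=; have := ltn_ord i; have := ltn_ord j; lia.
(* The X^m coefficient of [p] is minus the sum of the nodes, namely 0; the leading terms cancel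
   since [p] is monic. *)
- apply/leq_sizeP => k; rewrite coefB coefXn leq_eqVlt => /predU1P[<-|].
    have := @coefPn_prod_XsubC K (codom x); rewrite size_x -/p sum_x oppr0 /= => -> //.
    by rewrite ltn_eqF // subrr.
  rewrite leq_eqVlt => /predU1P[<-|lt_k].
    have := monic_prod_XsubC (codom x) xpredT id; rewrite -/p monicE lead_coefE size_p.
    by move=> /= /eqP ->; rewrite eqxx subrr.
  by rewrite gtn_eqF // nth_default ?subrr // size_p.
- rewrite !hornerE; have /eqP -> : root p (x j) by rewrite root_prod_XsubC codom_f.
  by rewrite subr0.
Qed.

(** * Ranks of monomials *)

Lemma waring_rank_eq (K : fieldType) m d (F : {mpoly K[m]}) r :
  has_waring_decomposition d F r ->
  (forall s, has_waring_decomposition d F s -> (r <= s)%N) ->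
  waring_rank d F = r.
Proof.
move=> Fr r_min; have [|Frk rk_min] := @waring_rankP K m d F; first by exists r.
by apply/eqP; rewrite eqn_leq rk_min ?r_min.
Qed.

(** The grid of nodes attains the lower bound given by independence of the box monomials. *)
Lemma waring_rank_monomial_form (K : numFieldType) n d (a : 'I_n.+1 -> nat)
    (x : forall i : 'I_n, 'I_(a (lift ord0 i)).+1 -> K) (g : 'I_n -> {poly K}) :
  (0 < a ord0)%N -> d = (\sum_(i < n.+1) a i)%N ->
  (forall i, injective (x i)) ->
  (forall i, size (g i) + a ord0 <= (a (lift ord0 i)).+1)%N ->
  (forall i j, x i j ^+ (a (lift ord0 i)).+1 = (g i).[x i j]) ->
  waring_rank d (monomial_form K a) = #|{: box (fun i : 'I_n => a (lift ord0 i))}|.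
Proof.
move=> a0_gt0 da x_inj size_g xg; apply: waring_rank_eq => [|s].
  have [c [u [w cuw]]] := box_dual_points x_inj size_g xg.
  exact: dual_points_has_waring_decomposition cuw.
by move=> /(has_waring_decomposition_dual_points da)[c [u [w /dual_points_card_ge]]]; apply.
Qed.

Theorem theorem3p5 (R : realType) (n d : nat) (a : 'I_n.+1 -> nat)
    (n_gt0 : (0 < n)%N) (a0_gt0 : (0 < a ord0)%N)
    (a_sorted : forall i j : 'I_n.+1, (i <= j)%N -> (a i <= a j)%N)
    (degM : d = (\sum_(i < n.+1) a i)%N) :
  waring_rank d (monomial_form R a) = waring_rank d (monomial_form R[i]%C a)
  <-> a ord0 = 1%N.
Proof.
pose box_a := box (fun i : 'I_n => a (lift ord0 i)).
have a0_le i : (a ord0 <= a (lift ord0 i))%N by apply: a_sorted.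
have -> : waring_rank d (monomial_form R[i]%C a) = #|{: box_a}|.
  have [x x_inj x1] : exists2 x : forall i : 'I_n, 'I_(a (lift ord0 i)).+1 -> R[i]%C,
      forall i, injective (x i) & forall i j, x i j ^+ (a (lift ord0 i)).+1 = 1.
    have ex i := unity_nodes R[i]%C (a (lift ord0 i)).
    exists (fun i => projT1 (cid2 (ex i))) => i; first by case: cid2.
    by case: cid2.
  (* For roots of unity [g] has size 1, so the size condition is just that [a ord0] is at most each
     other exponent. *)
  apply: (@waring_rank_monomial_form R[i]%C n d a x (fun=> 1)) => // i.
    by rewrite size_poly1 add1n ltnS.
  by move=> j; rewrite hornerE x1.
split=> [rankR|a01]; last first.
  have ex i := balanced_nodes R (a (lift ord0 i)).
  pose x i := projT1 (cid (ex i)).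
  have exg i : exists g : {poly R}, [/\ injective (x i), (size g <= a (lift ord0 i))%N
      & forall j, x i j ^+ (a (lift ord0 i)).+1 = g.[x i j]].
    by rewrite /x; case: cid.
  have /= gP i := projT2 (cid (exg i)).
  apply: (@waring_rank_monomial_form R n d a x (fun i => projT1 (cid (exg i)))) => // i.
  - by case: (gP i).
  (* With [a ord0 = 1] only the X^m coefficient must vanish, as balanced nodes ensure. *)
  - by rewrite a01 addn1 ltnS; case: (gP i).
  - by case: (gP i).
apply/eqP; rewrite eqn_leq a0_gt0 andbT leqNgt; apply/negP => a0_gt1.
have box_gt0 : (0 < #|{: box_a}|)%N by rewrite card_fprod prodn_gt0 // => i; rewrite card_ord.
have [FR|noFR] := pselect (exists s, has_waring_decomposition d (monomial_form R a) s).
  have [+ _] := waring_rankP FR; rewrite rankR.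
  move=> /(has_waring_decomposition_dual_points degM)[c [u [w]]].
  apply: (@real_dual_points_card_neq R n _ _ (Ordinal n_gt0)) => //.
  exact: leq_trans (a0_le _).
(* Without a real decomposition the rank would be the default 0, but it equals the positive cardinal
   of the box. *)
move: rankR box_gt0; rewrite /waring_rank; case: pselect => [exF|_ <- //].
by have [s /asboolP Fs] := exF; case: noFR; exists s.
Qed.
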